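(* Let $\Omega$ be a set, and consider either (i) the protocol of identically priced trials with a coherent cone $\mathcal{F}$ of real-valued functions on $\Omega$, or (ii) the protocol of Markov trials with, for each $\omega\in\Omega$, a coherent cone $\mathcal{F}(\omega)$ of real-valued functions on $\Omega$. Suppose that $E\subseteq\Omega^\infty$ is a weakly invariant event. Then, in either protocol, $E$ is either impossible or fully plausible; that is, $\overline{\mathbb{P}}(E)=0$ or $\overline{\mathbb{P}}(E)=1$.
   Context: A coherent cone on $\Omega$ is a non-empty set $\mathcal{F}$ of real-valued functions on $\Omega$ such that: (1) $F_1,F_2\in\mathcal{F}$ implies $F_1+F_2\in\mathcal{F}$; (2) $c\ge 0$ and $F\in\mathcal{F}$ imply $cF\in\mathcal{F}$; (3) there is no $F\in\mathcal{F}$ with $F(\omega)>0$ for all $\omega\in\Omega$. An event is an arbitrary subset of the set $\Omega^\infty$ of all infinite sequences of elements of $\Omega$ (no measurability is required). The shift $\theta:\Omega^\infty\to\Omega^\infty$ deletes the first element of a sequence, and $\theta E=\{\theta x : x\in E\}$. An event $E$ is weakly invariant if $\theta E\subseteq E$. Protocol of identically priced trials (parameters $\Omega$, $\mathcal{F}$): $\mathcal{K}_0=1$; on each trial $n=1,2,\ldots$ Skeptic announces $F_n\in\mathcal{F}$, then Reality announces $\omega_n\in\Omega$, and $\mathcal{K}_n:=\mathcal{K}_{n-1}+F_n(\omega_n)$. A strategy for Skeptic specifies each $F_n\in\mathcal{F}$ as a function of $\omega_1\ldots\omega_{n-1}$; then $\mathcal{K}_n$ is a function of $\omega_1\ldots\omega_n$.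 A strategy is prudent if $\mathcal{K}_n(\omega_1\ldots\omega_n)\ge 0$ for all $\omega_1\omega_2\ldots\in\Omega^\infty$ and all $n$. The upper probability $\overline{\mathbb{P}}(E)$ is the infimum of all $\epsilon>0$ such that Skeptic has a prudent strategy for which $\sup_{n=1,2,\ldots}\mathcal{K}_n(\omega_1\ldots\omega_n)\ge 1/\epsilon$ for all $\omega_1\omega_2\ldots\in E$. Protocol of Markov trials (parameters $\Omega$, $(\mathcal{F}(\omega))_{\omega\in\Omega}$): Reality first announces $\omega_0\in\Omega$; $\mathcal{K}_0=1$; on each trial $n=1,2,\ldots$ Skeptic announces $F_n\in\mathcal{F}(\omega_{n-1})$, then Reality announces $\omega_n\in\Omega$, and $\mathcal{K}_n:=\mathcal{K}_{n-1}+F_n(\omega_n)$. A strategy for Skeptic specifies each $F_n\in\mathcal{F}(\omega_{n-1})$ as a function of $\omega_0\omega_1\ldots\omega_{n-1}$; then $\mathcal{K}_n$ is a function of $\omega_0\omega_1\ldots\omega_n$. A strategy is prudent if $\mathcal{K}_n(\omega_0\omega_1\ldots\omega_n)\ge 0$ for all $\omega_0\omega_1\omega_2\ldots\in\Omega^\infty$ and all $n$. In this protocol $\overline{\mathbb{P}}(E)$ is the infimum of all $\epsilon>0$ such that Skeptic has a prudent strategy for which $\sup_{n=1,2,\ldots}\mathcal{K}_n(\omega_0\omega_1\ldots\omega_n)\ge 1/\epsilon$ for all $\omega_0\omega_1\omega_2\ldots\in E$. $E$ is impossible if $\overline{\mathbb{P}}(E)=0$ and fully plausible if $\overline{\mathbb{P}}(E)=1$.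 *)

(* Defs.v *)
From mathcomp Require Import all_boot all_order all_algebra.
From mathcomp Require Import boolp classical_sets reals constructive_ereal ereal.

Set Implicit Arguments.
Unset Strict Implicit.
Unset Printing Implicit Defensive.

Import Order.TTheory GRing.Theory Num.Theory.

Local Open Scope classical_set_scope.
Local Open Scope ring_scope.

Definition coherent_cone (R : realType) (Omega : Type)
    (F : set (Omega -> R)) : Prop :=
  [/\ F !=set0,
      forall f g, F f -> F g -> F (fun w => f w + g w),
      forall (c : R) f, 0 <= c -> F f -> F (fun w => c * f w)
    & ~ exists2 f, F f & forall w, 0 < f w].

(* A sequence in Omega^oo is a function x : nat -> Omega.                     *)
Definition shift_seq (Omega : Type) (x : nat -> Omega) : nat -> Omega :=
  fun n => x n.+1.

Definition weakly_invariant (Omega : Type) (E : set (nat -> Omega)) : Prop :=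
  (@shift_seq Omega) @` E `<=` E.

(* sup_{n = 1, 2, ...} u n in the extended reals (the index 0 is excluded).   *)
Definition sup_pos (R : realType) (u : nat -> R) : \bar R :=
  ereal_sup [set (u n)%:E | n in [set n | (1 <= n)%N]].

(* Identically priced trials.  Trials are numbered from 1, so the sequence    *)
(* omega_1 omega_2 ... is x with x i = omega_(i+1).  A strategy maps the      *)
(* history [:: omega_1; ...; omega_(n-1)] to the move F_n.                    *)
Definition ip_strategy (R : realType) (Omega : Type) (F : set (Omega -> R))
    (S : seq Omega -> Omega -> R) : Prop :=
  forall s, F (S s).

Fixpoint ip_capital (R : realType) (Omega : Type)
    (S : seq Omega -> Omega -> R) (x : nat -> Omega) (n : nat) : R :=
  if n is m.+1 then ip_capital S x m + S (mkseq x m) (x m) else 1.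

Definition ip_prudent (R : realType) (Omega : Type)
    (S : seq Omega -> Omega -> R) : Prop :=
  forall x n, 0 <= ip_capital S x n.

Definition ip_upper_prob (R : realType) (Omega : Type) (F : set (Omega -> R))
    (E : set (nat -> Omega)) : \bar R :=
  ereal_inf [set eps%:E | eps in [set eps : R | 0 < eps /\
    exists S, [/\ ip_strategy F S, ip_prudent S &
      forall x, E x -> ((eps^-1)%:E <= sup_pos (ip_capital S x))%E]]].

(* Markov trials.  Here x i = omega_i.  The non-empty history                 *)
(* omega_0 omega_1 ... omega_(n-1) is given to a strategy as its first        *)
(* element w0 and the list s of the others, so that last w0 s = omega_(n-1).  *)
Definition markov_strategy (R : realType) (Omega : Type)
    (F : Omega -> set (Omega -> R)) (S : Omega -> seq Omega -> Omega -> R) :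
    Prop :=
  forall w0 s, F (last w0 s) (S w0 s).

Fixpoint markov_capital (R : realType) (Omega : Type)
    (S : Omega -> seq Omega -> Omega -> R) (x : nat -> Omega) (n : nat) : R :=
  if n is m.+1 then
    markov_capital S x m + S (x 0%N) (mkseq (shift_seq x) m) (x m.+1)
  else 1.

Definition markov_prudent (R : realType) (Omega : Type)
    (S : Omega -> seq Omega -> Omega -> R) : Prop :=
  forall x n, 0 <= markov_capital S x n.

Definition markov_upper_prob (R : realType) (Omega : Type)
    (F : Omega -> set (Omega -> R)) (E : set (nat -> Omega)) : \bar R :=
  ereal_inf [set eps%:E | eps in [set eps : R | 0 < eps /\
    exists S, [/\ markov_strategy F S, markov_prudent S &
      forall x, E x -> ((eps^-1)%:E <= sup_pos (markov_capital S x))%E]]].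

(* Main.v *)
Require Import Defs.
From mathcomp Require Import all_boot all_order all_algebra.
From mathcomp Require Import boolp classical_sets reals constructive_ereal ereal.
From mathcomp Require Import lra.

(** Suppose that the upper probability of a weakly invariant event E is less
    than 1.  Then Skeptic, starting with capital 1, can raise it on E to some
    fixed level a > 1 in finite time without risking bankruptcy.  When the
    level is reached, the outcomes still to come form an iterated shift of the
    original sequence, hence again an element of E, so Skeptic can start again
    with all the money scaled accordingly and reach a * a, and so on.  The
    levels a ^+ k are unbounded, so the upper probability is 0.

    The heart is [markov_reaches_mul]: attainable levels multiply.  It rests on
    the strategy [restart], which follows one plan up to a given level and then
    a multiple of another strategy.  It remains to check that the upper
    probability is always between 0 and 1 and that attainable levels control it
    ([markov_upper_prob_le] and [markov_upper_prob_lt1]).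

    Identically priced trials reduce to Markov trials: give every state the
    same cone and let the initial state be a dummy that the event ignores
    ([ip_upper_prob_markov]). *)

Set Implicit Arguments.
Unset Strict Implicit.
Unset Printing Implicit Defensive.

Import Order.TTheory GRing.Theory Num.Theory.

Local Open Scope classical_set_scope.
Local Open Scope ring_scope.

(** * Capital along a path *)

(** Recursion on the first trial rather than on the last one: after an outcome
    the rest of the plan is again a plan, on the shifted sequence of outcomes.
    This is the form in which strategies can be switched by induction. *)
Fixpoint capital_from (R : realType) (Omega : Type) (k : R)
    (P : seq Omega -> Omega -> R) (y : nat -> Omega) (n : nat) : R :=
  if n is m.+1 then
    capital_from (k + P [::] (y 0%N)) (fun s => P (y 0%N :: s)) (shift_seq y) m
  else k.

Lemma mkseqS_shift (Omega : Type) (y : nat -> Omega) n :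
  mkseq y n.+1 = y 0%N :: mkseq (shift_seq y) n.
Proof. by rewrite /mkseq /= (iotaDl 1 0) -map_comp. Qed.

Lemma capital_fromSr (R : realType) (Omega : Type) (k : R)
    (P : seq Omega -> Omega -> R) y n :
  capital_from k P y n.+1 = capital_from k P y n + P (mkseq y n) (y n).
Proof.
elim: n k P y => [//|n IHn] k P y.
by rewrite -[LHS]/(capital_from _ _ _ n.+1) IHn mkseqS_shift.
Qed.

Lemma ip_capitalE (R : realType) (Omega : Type)
    (P : seq Omega -> Omega -> R) y n :
  ip_capital P y n = capital_from 1 P y n.
Proof. by elim: n => [//|n IHn]; rewrite capital_fromSr /= IHn. Qed.

Lemma markov_capitalE (R : realType) (Omega : Type)
    (S : Omega -> seq Omega -> Omega -> R) x n :
  markov_capital S x n = ip_capital (S (x 0%N)) (shift_seq x) n.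
Proof. by elim: n => [//|n IHn] /=; rewrite IHn. Qed.

Lemma capital_from_scale (R : realType) (Omega : Type) (a k : R)
    (P : seq Omega -> Omega -> R) y n :
  capital_from (a * k) (fun s v => a * P s v) y n = a * capital_from k P y n.
Proof. by elim: n k P y => [//|n IHn] k P y /=; rewrite -mulrDr IHn. Qed.

(** * Switching strategies when a level is reached *)

Section Restart.
Variables (R : realType) (Omega : Type) (c : R).
Variable T : Omega -> seq Omega -> Omega -> R.

(** Here [k] is the current capital, [w] the current state and [P] the rest of
    the plan being followed until the capital reaches [c].  From then on [T] is
    started afresh in the state [w], multiplied by the capital [k] available. *)
Fixpoint restart (k : R) (w : Omega) (P : seq Omega -> Omega -> R)
    (s : seq Omega) : Omega -> R :=
  if c <= k then fun v => k * T w s v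
  else if s is w1 :: s' then
    restart (k + P [::] w1) w1 (fun t => P (w1 :: t)) s'
  else P [::].

Lemma restart_after k w P :
  c <= k -> restart k w P = (fun s v => k * T w s v).
Proof. by move=> ck; apply/funext => -[|v s] /=; rewrite ck. Qed.

Lemma capital_restart_after k w P y n : c <= k ->
  capital_from k (restart k w P) y n = k * capital_from 1 (T w) y n.
Proof.
by move=> /(@restart_after _ w P) ->; rewrite -capital_from_scale mulr1.
Qed.

Lemma capital_restart_before k w P y n : k < c ->
  let k1 := k + P [::] (y 0%N) in
  capital_from k (restart k w P) y n.+1 =
  capital_from k1 (restart k1 (y 0%N) (fun t => P (y 0%N :: t)))
    (shift_seq y) n.
Proof. by rewrite ltNge => /negbTE ck /=; rewrite ck. Qed.

Lemma restart_strategy (F : Omega -> set (Omega -> R)) k w P s :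
  (forall v, coherent_cone (F v)) -> markov_strategy F T ->
  0 <= c -> (forall t, F (last w t) (P t)) ->
  F (last w s) (restart k w P s).
Proof.
move=> cohF FT c0; elim: s k w P => [|w1 s IHs] k w P FP /=.
  case: ifP => [ck|_]; last exact: (FP [::]).
  by case: (cohF w) => _ _ Z _; apply: Z; [exact: le_trans ck|exact: (FT w [::])].
case: ifP => [ck|_]; last by apply: IHs => t; exact: (FP (w1 :: t)).
case: (cohF (last w1 s)) => _ _ Z _.
by apply: Z; [exact: le_trans ck|exact: (FT w (w1 :: s))].
Qed.

(** Nonnegativity of the first plan is required only along the path in
    question, since the rest of a prudent plan is prudent only relative to the
    capital and the outcomes observed so far. *)
Lemma restart_prudent k w P y n :
  0 <= c -> markov_prudent T -> (forall m, 0 <= capital_from k P y m) ->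
  0 <= capital_from k (restart k w P) y n.
Proof.
move=> c0 T0; elim: n k w P y => [|n IHn] k w P y P0; first exact: (P0 0%N).
have [ck|kc] := leP c k; last first.
  by rewrite capital_restart_before //; apply: IHn => m; exact: (P0 m.+1).
rewrite capital_restart_after// mulr_ge0//; first exact: le_trans ck.
(* The sequence w, y 0, y 1, ... is a path of the protocol that starts in w. *)
have := T0 (fun i => if i is j.+1 then y j else w) n.+1.
by rewrite markov_capitalE ip_capitalE.
Qed.

(** Weak invariance enters here: it keeps the path in the event until the
    moment of the switch. *)
Lemma restart_reaches (E : set (nat -> Omega)) (b : R) k P x m :
  weakly_invariant E -> 0 <= c -> 0 <= b ->
  (forall z, E z -> exists n, b <= markov_capital T z n) ->
  E x -> c <= capital_from k P (shift_seq x) m ->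
  exists n, c * b <= capital_from k (restart k (x 0%N) P) (shift_seq x) n.
Proof.
move=> invE c0 b0 Tb; have after k' P' z : E z -> c <= k' -> exists n,
    c * b <= capital_from k' (restart k' (z 0%N) P') (shift_seq z) n.
  move=> /Tb[n bn] ck; exists n; rewrite capital_restart_after//.
  by rewrite ler_pM//; rewrite markov_capitalE ip_capitalE in bn.
elim: m k P x => [|m IHm] k P x Ex /= cm; first exact: after.
have [ck|kc] := leP c k; first exact: after.
have Esx : E (shift_seq x) by apply: invE; exists x.
have [n bn] := IHm _ _ _ Esx cm.
by exists n.+1; rewrite capital_restart_before.
Qed.

End Restart.

(** * Attainable levels in Markov trials *)

(** The level has to be attained and not merely be the supremum, so that there
    is a moment at which Skeptic can switch. *)
Definition markov_reaches (R : realType) (Omega : Type)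
    (F : Omega -> set (Omega -> R)) (E : set (nat -> Omega)) (a : R) : Prop :=
  exists S, [/\ markov_strategy F S, markov_prudent S &
    forall x, E x -> exists n, a <= markov_capital S x n].

Lemma expr_unbounded (R : realType) (a b : R) : 1 < a -> exists k, b < a ^+ k.
Proof.
move=> a1; have bernoulli k : 1 + k%:R * (a - 1) <= a ^+ k.
  elim: k => [|k IHk]; first by rewrite mul0r addr0 expr0.
  have ka2 : 0 <= k%:R * (a - 1) ^+ 2 by rewrite mulr_ge0 ?sqr_ge0.
  have a0 : 0 <= a by rewrite ltW// (lt_trans _ a1).
  rewrite exprS -natr1; apply: le_trans (ler_wpM2l a0 IHk).
  by rewrite expr2 in ka2; lra.
have a10 : 0 < a - 1 by rewrite subr_gt0.
exists (Num.bound (b / (a - 1))); apply: lt_le_trans (bernoulli _).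
have : b < (Num.bound (b / (a - 1)))%:R * (a - 1).
  by rewrite -ltr_pdivrMr// unstable.ltr_bound.
lra.
Qed.

Section MarkovZeroOne.
Variables (R : realType) (Omega : Type) (F : Omega -> set (Omega -> R)).
Variable E : set (nat -> Omega).
Hypothesis cohF : forall w, coherent_cone (F w).

Lemma cone0 w : F w (fun=> 0).
Proof.
have [[f Ff] _ Z _] := cohF w; have := Z 0 f (lexx 0) Ff.
by congr (F w _); apply/funext => v; rewrite mul0r.
Qed.

Lemma markov_capital0 x n :
  markov_capital (fun (_ : Omega) _ _ => 0 : R) x n = 1.
Proof. by elim: n => [//|n IHn] /=; rewrite IHn addr0. Qed.

Lemma markov_reaches1 : markov_reaches F E 1.
Proof.
exists (fun _ _ _ => 0); split => [w s|x n|x _]; first exact: cone0.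
- by rewrite markov_capital0.
- by exists 0%N.
Qed.

(** Weak invariance makes E as good for the second strategy, started when the
    first one has attained its level, as it is at the outset. *)
Lemma markov_reaches_mul a b : weakly_invariant E -> 0 <= a -> 0 <= b ->
  markov_reaches F E a -> markov_reaches F E b -> markov_reaches F E (a * b).
Proof.
move=> invE a0 b0 [S [FS S0 Sa]] [T [FT T0 Tb]].
exists (fun w => restart a T 1 w (S w)); split => [w s|x n|x Ex].
- by apply: restart_strategy => // t; exact: FS.
- rewrite markov_capitalE ip_capitalE; apply: restart_prudent => // m.
  by rewrite -ip_capitalE -markov_capitalE.
- have [m am] := Sa x Ex; rewrite markov_capitalE ip_capitalE in am.
  have [n abn] := restart_reaches invE a0 b0 Tb Ex am.
  by exists n; rewrite markov_capitalE ip_capitalE.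
Qed.

Lemma markov_reachesX a k : weakly_invariant E -> 0 <= a ->
  markov_reaches F E a -> markov_reaches F E (a ^+ k).
Proof.
move=> invE a0 Ea; elim: k => [|k IHk]; first exact: markov_reaches1.
by rewrite exprS; apply: markov_reaches_mul => //; rewrite exprn_ge0.
Qed.

(** A level above 1 cannot be attained at time 0, which the supremum in the
    upper probability leaves out. *)
Lemma markov_upper_prob_le a :
  1 < a -> markov_reaches F E a -> (markov_upper_prob F E <= (a^-1)%:E)%E.
Proof.
move=> a1 [S [FS S0 Sa]]; apply: ereal_inf_lbound; exists a^-1 => //=.
split; first by rewrite invr_gt0 (lt_trans _ a1).
exists S; split=> // x /Sa[n an]; rewrite invrK.
have n0 : (1 <= n)%N.
  by case: n an => //= a1'; rewrite leNgt a1 in a1'.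
apply: (@le_trans _ _ (markov_capital S x n)%:E); first by rewrite lee_fin.
by apply: ereal_sup_ubound; exists n.
Qed.

Lemma markov_upper_prob_ge0 : (0 <= markov_upper_prob F E)%E.
Proof.
by apply: le_ereal_inf_tmp => _ [eps [eps0 _] <-]; rewrite lee_fin ltW.
Qed.

Lemma markov_upper_prob_le1 : (markov_upper_prob F E <= 1)%E.
Proof.
apply: ereal_inf_lbound; exists 1 => //=; split => //.
exists (fun _ _ _ => 0); split => [w s|x n|x _]; first exact: cone0.
  by rewrite markov_capital0.
by rewrite invr1; apply: ereal_sup_ubound; exists 1%N;
  rewrite // markov_capital0.
Qed.

(** An upper probability below 1 promises only a supremum above 1; a slightly
    smaller level is attained in finite time. *)
Lemma markov_upper_prob_lt1 : (markov_upper_prob F E < 1)%E ->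
  exists2 a, 1 < a & markov_reaches F E a.
Proof.
move=> /ereal_inf_lt[_ [eps [eps0 [S [FS S0 SE]]] <-]]; rewrite lte_fin => eps1.
have [a1 ae] : 1 < (1 + eps^-1) / 2 /\ (1 + eps^-1) / 2 < eps^-1.
  by have := eps1; rewrite -invf_gt1// => /midf_lt[].
exists ((1 + eps^-1) / 2) => //; exists S; split => // x /SE SEx.
have : (((1 + eps^-1) / 2)%:E < sup_pos (markov_capital S x))%E.
  by apply: lt_le_trans SEx; rewrite lte_fin.
move=> /ereal_sup_gt[_ [n _ <-]]; rewrite lte_fin => an.
by exists n; exact: ltW.
Qed.

Lemma markov_zero_one : weakly_invariant E ->
  markov_upper_prob F E = 0%E \/ markov_upper_prob F E = 1%E.
Proof.
move=> invE; have [/markov_upper_prob_lt1[a a1 Ea]|P1] :=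
  ltP (markov_upper_prob F E) 1%E; last first.
  by right; apply/eqP; rewrite eq_le markov_upper_prob_le1.
left; apply/eqP; rewrite eq_le markov_upper_prob_ge0 andbT.
apply/lee_addgt0Pr => e e0; rewrite add0e.
have [k] := expr_unbounded (Num.max 1 e^-1) a1.
rewrite gt_max => /andP[k1 ke].
apply: le_trans (markov_upper_prob_le k1 (markov_reachesX k invE _ Ea)) _.
  by rewrite ltW// (lt_trans _ a1).
by rewrite lee_fin invf_ple ?posrE ?ltW// (lt_trans _ k1).
Qed.

End MarkovZeroOne.

(** * Identically priced trials as Markov trials *)

(** A strategy for identically priced trials ignores the dummy initial state.
    Conversely, freezing that state at [w] turns a Markov strategy into one for
    identically priced trials. *)
Lemma ip_upper_prob_markov (R : realType) (Omega : Type) (w : Omega)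
    (F : set (Omega -> R)) (E : set (nat -> Omega)) :
  ip_upper_prob F E =
  markov_upper_prob (fun=> F) (@shift_seq Omega @^-1` E).
Proof.
have markovE S x : markov_capital S x = ip_capital (S (x 0%N)) (shift_seq x).
  by apply/funext => n; rewrite markov_capitalE.
rewrite /ip_upper_prob /markov_upper_prob; congr (ereal_inf (image _ _)).
apply/seteqP; split => eps [eps0 [S [FS S0 SE]]]; split => //.
  exists (fun=> S); split => [_ s|x n|x Ex]; first exact: FS.
    by rewrite markovE.
  by rewrite markovE; exact: SE.
pose cons_w (y : nat -> Omega) i := if i is j.+1 then y j else w.
exists (S w); split => [s|y n|y Ey]; first exact: (FS w).
  by have := S0 (cons_w y) n; rewrite markovE.
by have := SE (cons_w y) Ey; rewrite markovE.
Qed.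

Lemma coherent_cone_inhabited (R : realType) (Omega : Type)
    (F : set (Omega -> R)) : coherent_cone F -> inhabited Omega.
Proof.
move=> [[f Ff] _ _ arbitrage]; apply: contrapT => empty.
by apply: arbitrage; exists f => // w; case: empty.
Qed.

Lemma weakly_invariant_preimage (Omega : Type) (E : set (nat -> Omega)) :
  weakly_invariant E -> weakly_invariant (@shift_seq Omega @^-1` E).
Proof. by move=> invE _ [x Ex <-]; apply: invE; exists (shift_seq x). Qed.

Theorem theorem2 (R : realType) (Omega : Type) (E : set (nat -> Omega))
    (invE : weakly_invariant E) :
  (forall F : set (Omega -> R), coherent_cone F ->
     ip_upper_prob F E = 0%E \/ ip_upper_prob F E = 1%E) /\
  (forall F : Omega -> set (Omega -> R), (forall w, coherent_cone (F w)) ->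
     markov_upper_prob F E = 0%E \/ markov_upper_prob F E = 1%E).
Proof.
split => [F cohF|F cohF]; last exact: markov_zero_one.
have [w] := coherent_cone_inhabited cohF; rewrite (ip_upper_prob_markov w).
by apply: markov_zero_one => //; exact: weakly_invariant_preimage.
Qed.
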